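(* Let $G=\mathbb F_2^{\,n}$. For every $A\subseteq G$ and every $\eta\in[0,1]$, $$\operatorname{per}_\eta(A)\ge\operatorname{ldr}^*_\eta(A).$$ More generally, let $A\subseteq G$, let $H\le G$ be a subspace, and let $0\le\alpha,\beta\le1$ with $\alpha+\beta\le1$. Suppose that there is a collection of cosets of $H$ (called exceptional) whose union has size at most $\beta|G|$, and that every other coset $x+H$ has $A$-density $|A\cap(x+H)|/|H|$ at most $\alpha$ or at least $1-\alpha$. Then $$[G:H]\ge\operatorname{ldr}^*_{\alpha+\beta}(A).$$
   Context: Ladders: a ladder of length $k$ in $A\subseteq G$ consists of $a_1,\dots,a_k,b_1,\dots,b_k\in G$ with $a_p+b_q\in A\iff p\le q$ for all $1\le p,q\le k$. The ladder index $\operatorname{ldr}(A)$ is the largest $k$ for which $A$ contains a ladder of length $k$, with $\operatorname{ldr}(\emptyset)=0$. For $\eta\in[0,1]$, $\operatorname{ldr}^*_\eta(A)=\min\{\operatorname{ldr}(A\triangle B):B\subseteq G,\ |B|\le\eta|G|\}$. A set $C\subseteq G$ is $H$-periodic if it is a union of cosets of the subspace $H\le G$. For $\eta\in[0,1]$, the periodic approximation index is $$\operatorname{per}_\eta(A)=\min\bigl\{[G:H]: H\le G,\ \text{some }H\text{-periodic }C\subseteq G\text{ satisfies }|A\triangle C|\le\eta|G|\bigr\}.$$ *)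

(* Defs.v *)
From HB Require Import structures.
From mathcomp Require Import all_boot all_order all_fingroup all_algebra.

Set Implicit Arguments.
Unset Strict Implicit.
Unset Printing Implicit Defensive.

Import Order.TTheory GRing.Theory Num.Theory.
Local Open Scope ring_scope.
Import VectorInternalTheory.

HB.instance Definition _ (F : finFieldType) (vT : vectType F) :=
  [Countable of {vspace vT} by <:].
HB.instance Definition _ (F : finFieldType) (vT : vectType F) :=
  [Finite of {vspace vT} by <:].

Section Definitions.
Variable n : nat.
Local Notation G := 'rV['F_2]_n.
Implicit Types (A B C S : {set G}) (H : {vspace G}).

Definition symdiff A B : {set G} := (A :\: B) :|: (B :\: A).

(* A ladder of length 0 always exists, so [ldr set0 = 0] needs no convention. *)
Definition has_ladder A (k : nat) : bool :=
  [exists a : {ffun 'I_k -> G}, exists b : {ffun 'I_k -> G},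
    [forall p, forall q, (a p + b q \in A) == (p <= q)%N]].

Lemma has_ladder0 A : exists k, has_ladder A k.
Proof.
exists 0%N; apply/existsP; exists [ffun=> 0]; apply/existsP; exists [ffun=> 0].
by apply/forallP=> -[].
Qed.

Lemma has_ladder_bound A k : has_ladder A k -> (k <= #|[set: G]|)%N.
Proof.
case/existsP=> a /existsP[b /forallP Pab].
have Pl p q : (a p + b q \in A) = (p <= q)%N by apply/eqP/(forallP (Pab p)).
have a_inj : injective a.
  move=> p p' eqa; apply/val_inj/eqP.
  by rewrite eqn_leq -!Pl eqa Pl leqnn -eqa Pl leqnn.
by rewrite cardsT -[k in (k <= _)%N]card_ord -(card_imset predT a_inj) max_card.
Qed.

Definition ldr A : nat := ex_maxn (has_ladder0 A) (@has_ladder_bound A).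

(* For [0 <= eta] the feasible set contains [set0], so the [arg min] below is a
   genuine minimum; for [eta < 0] the value is junk. *)
Definition ldr_star (R : realFieldType) (eta : R) A : nat :=
  ldr (symdiff A
    [arg min_(B < set0 | #|B|%:R <= eta * #|[set: G]|%:R) ldr (symdiff A B)]).

Definition cosets H : {set {set G}} :=
  [set [set x + h | h in H] | x in [set: G]].

Definition coset_index H : nat := #|cosets H|.

Definition periodic H C : bool :=
  [exists E : {set {set G}}, (E \subset cosets H) && (C == cover E)].

Definition approx_periodic (R : realFieldType) (eta : R) A H : bool :=
  [exists C : {set G},
    periodic H C && (#|symdiff A C|%:R <= eta * #|[set: G]|%:R)].

(* For [0 <= eta] the zero subspace is feasible (take [C = A]), so this too is
   a genuine minimum. *)
Definition per (R : realFieldType) (eta : R) A : nat :=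
  coset_index [arg min_(H < 0%VS | approx_periodic eta A H) coset_index H].

Definition density (R : realFieldType) A H S : R := #|A :&: S|%:R / #|H|%:R.

End Definitions.

(* Main.v *)
(** An [H]-periodic set has ladder index at most [[G : H]], since the entries
[a_p] of a ladder in it lie in distinct cosets of [H]; with [B = symdiff A C]
for a periodic approximant [C], [symdiff A B] is [C]. In the second part [C] is
the union of the non-exceptional cosets of density at least [1 - alpha]: it
differs from [A] in density at most [alpha] on each non-exceptional coset, and
in at most [beta * |G|] points elsewhere. *)
Require Import Defs.
From mathcomp Require Import all_boot all_order all_fingroup all_algebra.

Import Order.TTheory GRing.Theory Num.Theory.
Local Open Scope ring_scope.

Section Cosets.
Set Implicit Arguments.
Unset Strict Implicit.
Variable n : nat.
Local Notation G := 'rV['F_2]_n.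
Implicit Types (A B C S X : {set G}) (H : {vspace G}).

Lemma in_symdiff A B x : (x \in symdiff A B) = (x \in A) (+) (x \in B).
Proof. by rewrite !inE; do 2 case: (x \in _). Qed.

Lemma symdiffKl A C : symdiff A (symdiff A C) = C.
Proof. by apply/setP=> x; rewrite !in_symdiff addKb. Qed.

(** For a coset [S] and a union [C] of cosets, exactly these two cases occur; they give the error of
    the approximant [C] on [S]. *)
Lemma setI_symdiff A C S :
  (S \subset C -> symdiff A C :&: S = S :\: A) *
  ([disjoint S & C] -> symdiff A C :&: S = A :&: S).
Proof.
split=> [/subsetP sSC | dSC]; apply/setP=> x; rewrite !in_setI in_symdiff.
  rewrite in_setD; case: (boolP (x \in S)) => [/sSC->|]; last by rewrite !andbF.
  by rewrite addbT !andbT.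
case: (boolP (x \in S)) => [xS|]; last by rewrite !andbF.
by rewrite (disjointFr dSC xS) addbF.
Qed.

Lemma mem_coset_set H x y : (y \in [set x + h | h in H]) = (y - x \in H).
Proof.
apply/imsetP/idP => [[h Hh ->]|Hyx]; first by rewrite addrC addKr.
by exists (y - x); rewrite // addrC subrK.
Qed.

Lemma card_coset_set H S : S \in cosets H -> #|S| = #|H|.
Proof. by case/imsetP=> x _ ->; apply/card_imset/addrI. Qed.

(** Any point of a coset may serve as its representative, so two cosets with a common point
    coincide; each disjointness argument below rests on this. *)
Lemma coset_set_mem H S x : S \in cosets H -> x \in S ->
  S = [set x + h | h in H].
Proof.
case/imsetP=> y _ -> xy; apply/setP=> z; move: xy; rewrite !mem_coset_set => xy.
by rewrite -(rpredBr _ xy) opprB addrA subrK.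
Qed.

Lemma partition_cosets H : partition (cosets H) [set: G].
Proof.
apply/and3P; split.
- apply/eqP/setP=> x; rewrite inE; apply/bigcupP.
  exists [set x + h | h in H]; first exact: imset_f.
  by rewrite mem_coset_set subrr mem0v.
- apply/trivIsetP=> S T HS HT; apply: contraNT => /pred0Pn[x /andP[/= xS xT]].
  by rewrite (coset_set_mem HS xS) (coset_set_mem HT xT).
- by apply/imsetP=> -[x _ /setP/(_ x)]; rewrite mem_coset_set subrr mem0v inE.
Qed.

Lemma card_setI_cosets H X : #|X| = (\sum_(S in cosets H) #|X :&: S|)%N.
Proof.
have /and3P[/eqP cH tH _] := partition_cosets H.
transitivity (\sum_(x in cover (cosets H) | x \in X) 1)%N.
  by rewrite -sum1_card; apply: eq_bigl => x; rewrite cH inE.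
rewrite big_trivIset_cond //; apply: eq_bigr => S _.
by rewrite -sum1_card; apply: eq_bigl => x; rewrite inE andbC.
Qed.

Lemma periodic_mem H C x y :
  periodic H C -> x - y \in H -> (x \in C) = (y \in C).
Proof.
case/existsP=> E /andP[/subsetP sE /eqP->].
suff impl u v : u - v \in H -> u \in cover E -> v \in cover E.
  (* One implication suffices, as [H] is closed under negation. *)
  by move=> xy; apply/idP/idP; apply: impl; rewrite // -opprB rpredN.
move=> uv /bigcupP[S SE uS]; apply/bigcupP; exists S => //.
by rewrite (coset_set_mem (sE _ SE) uS) mem_coset_set -opprB rpredN.
Qed.

Lemma ldr_periodic H C : periodic H C -> (ldr C <= coset_index H)%N.
Proof.
move=> perC; rewrite /ldr; case: ex_maxnP => k + _.
case/existsP=> a /existsP[b /forallP lad].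
have ladE p q : (a p + b q \in C) = (p <= q)%N by apply/eqP/(forallP (lad p)).
pose f p := [set a p + h | h in H].
have f_inj : injective f.
  move=> p p' /setP/(_ (a p)); rewrite !mem_coset_set subrr mem0v => /esym Hpp'.
  (* If [a p] and [a p'] lie in one coset, so do [a p + b q] and [a p' + b q] for each [q]. The
     cases [q = p] and [q = p'] then force [p = p']. *)
  have mono (q : 'I_k) : (p <= q)%N = (p' <= q)%N.
    by rewrite -!ladE; apply: (periodic_mem perC);
       rewrite opprD addrACA subrr addr0.
  by apply/val_inj/eqP; rewrite eqn_leq mono leqnn -mono leqnn.
rewrite -[k]card_ord -(card_imset predT f_inj); apply: subset_leq_card.
by apply/subsetP=> _ /imsetP[p _ ->]; apply: imset_f.
Qed.

Lemma ldr_star_le (R : realFieldType) (eta : R) A H :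
  0 <= eta -> approx_periodic eta A H -> (ldr_star eta A <= coset_index H)%N.
Proof.
move=> eta0 /existsP[C /andP[perC leC]]; rewrite /ldr_star.
(* Feasibility of the default [set0] comes first; minimality is then tested against
   [symdiff A C]. *)
case: arg_minnP => [|B _ minB]; first by rewrite cards0 mulr_ge0.
by rewrite (leq_trans (minB _ leC)) // symdiffKl ldr_periodic.
Qed.

Lemma approx_periodic0 (R : realFieldType) (eta : R) A :
  0 <= eta -> approx_periodic eta A 0%VS.
Proof.
move=> eta0; apply/existsP; exists A; apply/andP; split; last first.
  suff ->: symdiff A A = set0 by rewrite cards0 mulr_ge0.
  by apply/setP=> x; rewrite in_symdiff addbb inE.
(* Cosets of the zero subspace are singletons, so [A] is the union of the cosets of its points. *)
apply/existsP; exists [set [set x + h | h in (0%VS : {vspace G})] | x in A].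
rewrite imsetS ?subsetT //=; apply/eqP/setP=> x; apply/idP/bigcupP => [xA|].
  exists [set x + h | h in (0%VS : {vspace G})]; first exact: imset_f.
  by rewrite mem_coset_set subrr mem0v.
by case=> _ /imsetP[y yA ->]; rewrite mem_coset_set memv0 subr_eq0 => /eqP->.
Qed.

Lemma approx_periodic_regular (R : realFieldType) A H (alpha beta : R)
    (E : {set {set G}}) :
  0 <= alpha -> E \subset cosets H ->
  #|cover E|%:R <= beta * #|[set: G]|%:R ->
  (forall S, S \in cosets H :\: E ->
     density R A H S <= alpha \/ 1 - alpha <= density R A H S) ->
  approx_periodic (alpha + beta) A H.
Proof.
move=> alpha0 sE leE reg.
have partH := partition_cosets H; have /and3P[_ tH _] := partH.
pose D := [set S in cosets H :\: E | 1 - alpha <= density R A H S].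
have sD : D \subset cosets H.
  by apply/subsetP=> S; rewrite !inE => /andP[/andP[_ ->]].
apply/existsP; exists (cover D); apply/andP; split.
  by apply/existsP; exists D; rewrite sD /=.
set X := symdiff A _.
have H0 : 0 < #|H|%:R :> R.
  by rewrite ltr0n; apply/card_gt0P; exists 0; rewrite mem0v.
(* On a coset in [D] the error is [S :\: A], whose density is one minus that of [A]. On any other
   non-exceptional coset it is [A :&: S], and the dichotomy leaves only density at most [alpha]. *)
have regX S : S \in cosets H :\: E -> #|X :&: S|%:R <= alpha * #|S|%:R.
  move=> SHE; have /setDP[SH _] := SHE; have cS := card_coset_set SH.
  case: (boolP (S \in D)) => SD.
    rewrite (setI_symdiff _ _ _).1; last exact: bigcup_sup.
    move: SD; rewrite inE SHE /= /density ler_pdivlMr // -cS.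
    rewrite mulrBl mul1r => leS.
    by rewrite -(lerD2l #|A :&: S|%:R) -natrD setIC cardsID setIC -lerBlDr.
  rewrite (setI_symdiff _ _ _).2; last first.
    rewrite -setI_eq0 -subset0; apply/subsetP=> x /setIP[xS /bigcupP[T TD xT]].
    have TS : T = S.
      by rewrite (coset_set_mem SH xS) (coset_set_mem (subsetP sD _ TD) xT).
    by rewrite -TS TD in SD.
  case: (reg S SHE) => [|leS]; first by rewrite /density ler_pdivrMr // cS.
  by rewrite inE SHE leS in SD.
have cT : #|[set: G]| = (\sum_(S in cosets H) #|S|)%N.
  by apply: card_partition.
rewrite (card_setI_cosets H X) (big_setID E) /= (setIidPr sE) natrD.
(* The cosets in [E] are charged to [beta], being bounded by their full size; the others are charged
   to [alpha]. *)
rewrite mulrDl [leRHS]addrC lerD //.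
  apply: le_trans leE; rewrite ler_nat -(eqP (trivIsetS sE tH)).
  by apply: leq_sum => S _; apply: subset_leq_card; apply: subsetIr.
rewrite cT natr_sum [X in alpha * X]natr_sum mulr_sumr.
rewrite [leRHS](big_setID E) /= (setIidPr sE) -[leLHS]add0r lerD //.
  by apply: sumr_ge0 => S _; rewrite mulr_ge0.
by apply: ler_sum => S /regX.
Qed.

End Cosets.

Theorem proposition6p2 (R : realFieldType) (n : nat) :
  (forall (A : {set 'rV['F_2]_n}) (eta : R),
     0 <= eta <= 1 -> (ldr_star eta A <= per eta A)%N)
  /\
  (forall (A : {set 'rV['F_2]_n}) (H : {vspace 'rV['F_2]_n}) (alpha beta : R),
     0 <= alpha <= 1 -> 0 <= beta <= 1 -> alpha + beta <= 1 ->
     (exists E : {set {set 'rV['F_2]_n}},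
        [/\ E \subset cosets H,
            #|cover E|%:R <= beta * #|[set: 'rV['F_2]_n]|%:R
          & forall S : {set 'rV['F_2]_n}, S \in cosets H :\: E ->
              density R A H S <= alpha \/ 1 - alpha <= density R A H S]) ->
     (ldr_star (alpha + beta) A <= coset_index H)%N).
Proof.
split=> [A eta /andP[eta0 _] | A H alpha beta].
  rewrite /per; case: arg_minnP => [|H perH _]; first exact: approx_periodic0.
  exact: ldr_star_le.
move=> /andP[alpha0 _] /andP[beta0 _] _ [E [sE leE reg]].
by apply: ldr_star_le; rewrite ?addr_ge0 //; apply: approx_periodic_regular reg.
Qed.
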